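(* Let $\mathcal{C}$ be a regular category. There is a one-to-one correspondence between connectors $(A,p)$ in $\mathcal{C}$ (that is, an object $A$, equivalence relations $R,S$ on $A$, and a connector $p\colon R\times_A S\to A$ between $R$ and $S$) and normal dagger Frobenius 3-structures $(A,m)$ in $\mathrm{Rel}(\mathcal{C})$. Under this correspondence the relation $m\colon A\times A\times A \to A$ is $(x,y,z)\mapsto p(x,y,z)$ whenever $p(x,y,z)$ is defined; i.e. $m((x,y,z),u)$ holds iff $(x,y,z)\in R\times_A S$ and $p(x,y,z)=u$.
   Context: **Regular categories and relations.** For a regular category $\mathcal{C}$, the category $\mathrm{Rel}(\mathcal{C})$ has the objects of $\mathcal{C}$, and its morphisms $A\to B$ are the subobjects $R \rightarrowtail A\times B$. Composition is relational composition, $(S\circ R)(a,c)\iff(\exists b)\,R(a,b)\wedge S(b,c)$ in the internal regular logic. It is a symmetric monoidal dagger category, with tensor given by the product of $\mathcal{C}$, tensor unit $I=1$, and dagger given by the opposite relation. Every object is its own dagger dual: $A^*=A$, with all four duality morphisms $\eta\colon I\to A^*\otimes A$, $\varepsilon\colon A\otimes A^*\to I$, $\eta'\colon I\to A\otimes A^*$, $\varepsilon'\colon A^*\otimes A\to I$ given by the diagonal $\{(a,a)\mid a\in A\}\rightarrowtail A\times A$. Formulas with variables are interpreted in the internal regular logic of $\mathcal{C}$. **Connectors.** Let $R$ and $S$ be equivalence relations on an object $A$ of $\mathcal{C}$, and let $R\times_A S = \{(x,y,z)\in A^3 \mid R(x,y)\wedge S(y,z)\}$. A connector between $R$ and $S$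 is a morphism $p\colon R\times_A S\to A$ in $\mathcal{C}$ such that: - $S(x,p(x,y,z))$ and $R(z,p(x,y,z))$ for $(x,y,z)\in R\times_A S$; - $p(x,y,y)=x$ and $p(y,y,z)=z$ whenever defined; - $p(p(x,y,z),u,v)=p(x,y,p(z,u,v))$, meaning that if one side is defined then so is the other and they are equal. **Normal dagger Frobenius 3-structures.** In a monoidal dagger category, let $A$ and $A^*$ be dagger dual via $\eta,\varepsilon,\eta'=\varepsilon^\dagger,\varepsilon'=\eta^\dagger$. A dagger Frobenius 3-structure on $A$ is a morphism $m\colon A\otimes A^*\otimes A\to A$ satisfying associativity $$m\circ(\mathrm{id}_A\otimes\mathrm{id}_{A^*}\otimes m)=m\circ(m\otimes\mathrm{id}_{A^*}\otimes\mathrm{id}_A)$$ and dagger symmetry $$(m\otimes\mathrm{id}_{A^*}\otimes\mathrm{id}_A)\circ(\mathrm{id}_A\otimes\mathrm{id}_{A^*}\otimes\eta'\otimes\mathrm{id}_A)\circ(\mathrm{id}_A\otimes\eta)=m^\dagger=(\mathrm{id}_A\otimes\mathrm{id}_{A^*}\otimes m)\circ(\mathrm{id}_A\otimes\eta\otimes\mathrm{id}_{A^*}\otimes\mathrm{id}_A)\circ(\eta'\otimes\mathrm{id}_A).$$ It is normal when its left loop $m\circ(\eta'\otimes\mathrm{id}_A)$ and its right loop $m\circ(\mathrm{id}_A\otimes\eta)$ both equal $\mathrm{id}_A$. In $\mathrm{Rel}(\mathcal{C})$ the self-dualities above are used. *)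

(* Defs.v *)
From HB Require Import structures.
From mathcomp Require Import all_boot.
From mathcomp Require Import boolp.

Set Implicit Arguments.
Unset Strict Implicit.
Unset Printing Implicit Defensive.

Declare Scope cat_scope.
Delimit Scope cat_scope with C.
Local Open Scope cat_scope.

Reserved Notation "g ∘ f" (at level 40, left associativity).
Reserved Notation "⟨ f , g ⟩" (at level 0, f at level 99, g at level 99).
Reserved Notation "f ^†" (at level 1, left associativity, format "f ^†").
Reserved Notation "A ⊗ B" (at level 39, left associativity).
Reserved Notation "f ⊠ g" (at level 39, left associativity).
Reserved Notation "A × B" (at level 39, left associativity).

Record category := Category {
  obj :> Type;
  hom : obj -> obj -> Type;
  idc : forall A, hom A A;
  compc : forall A B D, hom B D -> hom A B -> hom A D;
  compA : forall A B D E (h : hom D E) (g : hom B D) (f : hom A B),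
    compc h (compc g f) = compc (compc h g) f;
  comp1c : forall A B (f : hom A B), compc (idc B) f = f;
  compc1 : forall A B (f : hom A B), compc f (idc A) = f
}.

Arguments hom {c} A B.
Arguments idc {c} A.
Arguments compc {c A B D} g f.
Notation "g ∘ f" := (compc g f) : cat_scope.

Definition monic (C : category) (A B : C) (m : hom A B) : Prop :=
  forall X (f g : hom X A), m ∘ f = m ∘ g -> f = g.

Definition is_coequalizer (C : category) (K A Q : C) (u v : hom K A)
    (q : hom A Q) : Prop :=
  q ∘ u = q ∘ v /\
  forall X (f : hom A X), f ∘ u = f ∘ v -> exists! h : hom Q X, h ∘ q = f.

Definition regular_epi (C : category) (A Q : C) (q : hom A Q) : Prop :=
  exists (K : C) (u v : hom K A), is_coequalizer u v q.

(** A regular category, with chosen structure: finite limits (given by a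
    terminal object, binary products and pullbacks), factorisation of every morphism as a regular epi followed by a mono, and
    stability of regular epis under pullback. *)

Record regular_category := RegularCategory {
  reg_cat :> category;

  term : reg_cat;
  bang : forall A, hom A term;
  bang_uniq : forall A (f : hom A term), f = bang A;

  prodc : reg_cat -> reg_cat -> reg_cat;
  pr1 : forall A B, hom (prodc A B) A;
  pr2 : forall A B, hom (prodc A B) B;
  pairc : forall X A B, hom X A -> hom X B -> hom X (prodc A B);
  pr1_pair : forall X A B (f : hom X A) (g : hom X B),
    pr1 A B ∘ pairc f g = f;
  pr2_pair : forall X A B (f : hom X A) (g : hom X B),
    pr2 A B ∘ pairc f g = g;
  prodc_ext : forall X A B (f g : hom X (prodc A B)),
    pr1 A B ∘ f = pr1 A B ∘ g -> pr2 A B ∘ f = pr2 A B ∘ g -> f = g;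

  pb : forall A B D, hom A D -> hom B D -> reg_cat;
  pb1 : forall A B D (f : hom A D) (g : hom B D), hom (pb f g) A;
  pb2 : forall A B D (f : hom A D) (g : hom B D), hom (pb f g) B;
  pb_comm : forall A B D (f : hom A D) (g : hom B D),
    f ∘ pb1 f g = g ∘ pb2 f g;
  pb_univ : forall A B D (f : hom A D) (g : hom B D)
      X (a : hom X A) (b : hom X B),
    f ∘ a = g ∘ b ->
    exists! h : hom X (pb f g), pb1 f g ∘ h = a /\ pb2 f g ∘ h = b;

  im : forall A B, hom A B -> reg_cat;
  im_epi : forall A B (f : hom A B), hom A (im f);
  im_mono : forall A B (f : hom A B), hom (im f) B;
  im_fact : forall A B (f : hom A B), im_mono f ∘ im_epi f = f;
  im_epiP : forall A B (f : hom A B), regular_epi (im_epi f);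
  im_monoP : forall A B (f : hom A B), monic (im_mono f);

  regular_epi_pb : forall A B D (e : hom A D) (g : hom B D),
    regular_epi e -> regular_epi (pb2 e g)
}.

Arguments term {r}.
Arguments bang {r} A.
Arguments prodc {r} A B.
Arguments pr1 {r A B}.
Arguments pr2 {r A B}.
Arguments pairc {r X A B} f g.
Arguments pb {r A B D} f g.
Arguments pb1 {r A B D} f g.
Arguments pb2 {r A B D} f g.
Arguments im {r A B} f.
Arguments im_epi {r A B} f.
Arguments im_mono {r A B} f.
Notation "A × B" := (prodc A B) : cat_scope.
Notation "⟨ f , g ⟩" := (pairc f g) : cat_scope.

(** A subobject is an isomorphism class of monos, so that Leibniz equality of
    subobjects is the intended one. *)

Record mono_to (C : category) (X : C) := MonoTo {
  mono_dom : C;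
  mono_arr : hom mono_dom X;
  mono_arrP : monic mono_arr
}.
Arguments MonoTo {C X mono_dom mono_arr}.

HB.instance Definition _ (C : category) (X : C) := gen_eqMixin (mono_to X).
HB.instance Definition _ (C : category) (X : C) := gen_choiceMixin (mono_to X).

Section Subobjects.
Context {C : category}.

Definition mono_le (X : C) (r s : mono_to X) : Prop :=
  exists h, mono_arr s ∘ h = mono_arr r.

Definition mono_eqv (X : C) : rel (mono_to X) :=
  fun r s => `[< mono_le r s /\ mono_le s r >].

Lemma mono_le_refl (X : C) (r : mono_to X) : mono_le r r.
Proof. by exists (idc _); rewrite compc1. Qed.

Lemma mono_le_trans (X : C) (r s t : mono_to X) :
  mono_le r s -> mono_le s t -> mono_le r t.
Proof. by move=> [h hE] [k kE]; exists (k ∘ h); rewrite compA kE. Qed.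

Lemma mono_eqv_refl (X : C) : reflexive (@mono_eqv X).
Proof. by move=> r; apply/asboolP; split; exact: mono_le_refl. Qed.

Lemma mono_eqv_sym (X : C) : symmetric (@mono_eqv X).
Proof. by move=> r s; apply: asbool_equiv_eq; split=> -[]. Qed.

Lemma mono_eqv_trans (X : C) : transitive (@mono_eqv X).
Proof.
move=> s r t /asboolP [rs sr] /asboolP [st ts]; apply/asboolP.
by split; [exact: mono_le_trans st | exact: mono_le_trans sr].
Qed.

Canonical mono_eqv_equiv (X : C) :=
  EquivRel (@mono_eqv X) (@mono_eqv_refl X) (@mono_eqv_sym X)
    (@mono_eqv_trans X).

Definition subobject (X : C) : Type := {eq_quot @mono_eqv X}%qT.

Definition subobj_of (X : C) (r : mono_to X) : subobject X :=
  \pi_({eq_quot @mono_eqv X})%qT r.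

Definition sub_mono (X : C) (U : subobject X) : mono_to X := repr U.

Definition sub_dom (X : C) (U : subobject X) : C := mono_dom (sub_mono U).
Definition sub_arr (X : C) (U : subobject X) : hom (sub_dom U) X :=
  mono_arr (sub_mono U).

(** The generalised element [x], defined at stage [Y], satisfies [U]. *)
Definition holds (X Y : C) (U : subobject X) (x : hom Y X) : Prop :=
  exists h : hom Y (sub_dom U), sub_arr U ∘ h = x.

Lemma sub_arrP (X : C) (U : subobject X) : monic (sub_arr U).
Proof. exact: mono_arrP. Qed.

Lemma subobj_ofK (X : C) (U : subobject X) : subobj_of (sub_mono U) = U.
Proof. exact: reprK. Qed.

Lemma holds_of (X Y : C) (r : mono_to X) (x : hom Y X) :
  holds (subobj_of r) x <-> exists h, mono_arr r ∘ h = x.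
Proof.
have /eqmodP/asboolP [[h hE] [k kE]] :
    sub_mono (subobj_of r) = r %[mod {eq_quot @mono_eqv X}]%qT.
  exact: reprK.
split=> -[l <-].
- by exists (h ∘ l); rewrite compA hE.
- by exists (k ∘ l); rewrite compA /sub_arr kE.
Qed.

Lemma holds_comp (X Y Z : C) (U : subobject X) (x : hom Y X) (f : hom Z Y) :
  holds U x -> holds U (x ∘ f).
Proof. by move=> [h <-]; exists (h ∘ f); rewrite compA. Qed.

Lemma subobj_ext (X : C) (U V : subobject X) :
  (forall Y (x : hom Y X), holds U x <-> holds V x) -> U = V.
Proof.
move=> UV; rewrite -(subobj_ofK U) -(subobj_ofK V).
apply/eqmodP/asboolP; split.
- by apply/(UV _ (sub_arr U)); exists (idc _); rewrite compc1.
- by apply/(UV _ (sub_arr V)); exists (idc _); rewrite compc1.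
Qed.

Lemma regular_epi_id (X : C) : regular_epi (idc X).
Proof.
exists X, (idc X), (idc X); split=> // Y f _; exists f.
by split=> [|h]; rewrite compc1.
Qed.

Lemma regular_epi_epi (X Y Z : C) (e : hom Y X) (f g : hom X Z) :
  regular_epi e -> f ∘ e = g ∘ e -> f = g.
Proof.
move=> [K [u [v [euv eU]]]] fg.
have [|h [_ hU]] := eU _ (f ∘ e); first by rewrite -!compA euv.
by rewrite -(hU f) // -(hU g).
Qed.

Lemma holds_descent (X Y Z : C) (U : subobject X) (x : hom Y X) (e : hom Z Y) :
  regular_epi e -> holds U (x ∘ e) -> holds U x.
Proof.
move=> ee [h hE]; have [K [u [v [euv eU]]]] := ee.
have huv : h ∘ u = h ∘ v.
  by apply: (@sub_arrP _ U); rewrite !compA hE -!compA euv.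
have [k [kE _]] := eU _ _ huv.
by exists k; apply: (regular_epi_epi ee); rewrite -compA kE.
Qed.

End Subobjects.

(** The inverses of the coherence isomorphisms are their daggers. *)

Record monoidal_dagger_category := MonoidalDaggerCategory {
  md_cat :> category;

  dag : forall A B : md_cat, hom A B -> hom B A;
  dagK : forall (A B : md_cat) (f : hom A B), dag (dag f) = f;
  dag_id : forall A : md_cat, dag (idc A) = idc A;
  dag_comp : forall (A B D : md_cat) (g : hom B D) (f : hom A B),
    dag (g ∘ f) = dag f ∘ dag g;

  munit : md_cat;
  tens : md_cat -> md_cat -> md_cat;
  tensh : forall A A' B B' : md_cat,
    hom A A' -> hom B B' -> hom (tens A B) (tens A' B');
  tens_id : forall A B : md_cat, tensh (idc A) (idc B) = idc (tens A B);
  tens_comp : forall (A A' A'' B B' B'' : md_cat)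
      (f' : hom A' A'') (f : hom A A') (g' : hom B' B'') (g : hom B B'),
    tensh (f' ∘ f) (g' ∘ g) = tensh f' g' ∘ tensh f g;
  dag_tens : forall (A A' B B' : md_cat) (f : hom A A') (g : hom B B'),
    dag (tensh f g) = tensh (dag f) (dag g);

  assoc : forall A B D : md_cat, hom (tens (tens A B) D) (tens A (tens B D));
  lunit : forall A : md_cat, hom (tens munit A) A;
  runit : forall A : md_cat, hom (tens A munit) A;
  assoc_nat : forall (A A' B B' D D' : md_cat)
      (f : hom A A') (g : hom B B') (h : hom D D'),
    assoc A' B' D' ∘ tensh (tensh f g) h = tensh f (tensh g h) ∘ assoc A B D;
  lunit_nat : forall (A A' : md_cat) (f : hom A A'),
    lunit A' ∘ tensh (idc munit) f = f ∘ lunit A;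
  runit_nat : forall (A A' : md_cat) (f : hom A A'),
    runit A' ∘ tensh f (idc munit) = f ∘ runit A;
  assoc_dag : forall A B D, dag (assoc A B D) ∘ assoc A B D = idc _;
  dag_assoc : forall A B D, assoc A B D ∘ dag (assoc A B D) = idc _;
  lunit_dag : forall A, dag (lunit A) ∘ lunit A = idc _;
  dag_lunit : forall A, lunit A ∘ dag (lunit A) = idc _;
  runit_dag : forall A, dag (runit A) ∘ runit A = idc _;
  dag_runit : forall A, runit A ∘ dag (runit A) = idc _;
  pentagon : forall A B D E : md_cat,
    tensh (idc A) (assoc B D E) ∘ assoc A (tens B D) E
      ∘ tensh (assoc A B D) (idc E)
    = assoc A B (tens D E) ∘ assoc (tens A B) D E;
  triangle : forall A B : md_cat,
    tensh (idc A) (lunit B) ∘ assoc A munit B = tensh (runit A) (idc B)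
}.

Arguments dag {m A B} f.
Arguments munit {m}.
Arguments tens {m} A B.
Arguments tensh {m A A' B B'} f g.
Arguments assoc {m} A B D.
Arguments lunit {m} A.
Arguments runit {m} A.
Notation "f ^†" := (dag f) : cat_scope.
Notation "A ⊗ B" := (tens A B) : cat_scope.
Notation "f ⊠ g" := (tensh f g) : cat_scope.

(** [As] is a dagger dual of [A]; the snake equations for
    [eta' = eps^†] and [eps' = eta^†] are the daggers of these. *)
Record dagger_dual (M : monoidal_dagger_category) (A As : M) := DaggerDual {
  eta : hom munit (As ⊗ A);
  eps : hom (A ⊗ As) munit;
  snake : lunit A ∘ (eps ⊠ idc A) ∘ (assoc A As A)^† ∘ (idc A ⊠ eta)
            ∘ (runit A)^† = idc A;
  snake_dual : runit As ∘ (idc As ⊠ eps) ∘ assoc As A As ∘ (eta ⊠ idc As)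
            ∘ (lunit As)^† = idc As
}.

Section Frobenius3.
Context {M : monoidal_dagger_category} {A As : M} (D : dagger_dual A As).

Definition eta' : hom munit (A ⊗ As) := (eps D)^†.

Variable m : hom (A ⊗ As ⊗ A) A.

Definition reassoc : hom (A ⊗ As ⊗ A ⊗ As ⊗ A) ((A ⊗ As) ⊗ (A ⊗ As ⊗ A)) :=
  assoc (A ⊗ As) (A ⊗ As) A ∘ (assoc (A ⊗ As) A As ⊠ idc A).

Definition frob3_assoc : Prop :=
  m ∘ (idc A ⊠ idc As ⊠ m) ∘ reassoc = m ∘ (m ⊠ idc As ⊠ idc A).

(** Reading from right to left, with coherence isomorphisms inserted:
    [A → A ⊗ (As ⊗ A) → (A ⊗ As) ⊗ (A ⊗ As) ⊗ A → (A ⊗ As ⊗ A) ⊗ As ⊗ A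
       → A ⊗ As ⊗ A]. *)
Definition frob3_left : hom A (A ⊗ As ⊗ A) :=
  (m ⊠ idc As ⊠ idc A)
  ∘ ((assoc (A ⊗ As) A As)^† ⊠ idc A)
  ∘ (idc A ⊠ idc As ⊠ eta' ⊠ idc A)
  ∘ ((runit (A ⊗ As))^† ⊠ idc A)
  ∘ (assoc A As A)^†
  ∘ (idc A ⊠ eta D)
  ∘ (runit A)^†.

(** Similarly
    [A → (A ⊗ As) ⊗ A → (A ⊗ (As ⊗ A)) ⊗ As ⊗ A → (A ⊗ As) ⊗ (A ⊗ As ⊗ A)
       → A ⊗ As ⊗ A]; the last arrow lands in [(A ⊗ As) ⊗ A]. *)
Definition frob3_right : hom A (A ⊗ As ⊗ A) :=
  (idc A ⊠ idc As ⊠ m)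
  ∘ reassoc
  ∘ ((assoc A As A)^† ⊠ idc As ⊠ idc A)
  ∘ (idc A ⊠ eta D ⊠ idc As ⊠ idc A)
  ∘ ((runit A)^† ⊠ idc As ⊠ idc A)
  ∘ (eta' ⊠ idc A)
  ∘ (lunit A)^†.

Definition left_loop : hom A A := m ∘ (eta' ⊠ idc A) ∘ (lunit A)^†.

Definition right_loop : hom A A :=
  m ∘ (assoc A As A)^† ∘ (idc A ⊠ eta D) ∘ (runit A)^†.

Record is_frob3 : Prop := IsFrob3 {
  frob3_assocP : frob3_assoc;
  frob3_leftP : frob3_left = m^†;
  frob3_rightP : m^† = frob3_right
}.

Definition frob3_normal : Prop := left_loop = idc A /\ right_loop = idc A.

End Frobenius3.

Record normal_frob3 (M : monoidal_dagger_category) (A As : M)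
    (D : dagger_dual A As) := NormalFrob3 {
  frob3_mul :> hom (A ⊗ As ⊗ A) A;
  frob3_mulP : is_frob3 D frob3_mul;
  frob3_mul_normal : frob3_normal D frob3_mul
}.

Section Relations.
Context {C : regular_category}.
Implicit Types A B D E X Y : C.

Lemma pairc_comp X Y A B (f : hom X A) (g : hom X B) (h : hom Y X) :
  ⟨f, g⟩ ∘ h = ⟨f ∘ h, g ∘ h⟩.
Proof. by apply: prodc_ext; rewrite compA !(pr1_pair, pr2_pair). Qed.

Lemma pairc_eta X A B (f : hom X (A × B)) : ⟨pr1 ∘ f, pr2 ∘ f⟩ = f.
Proof. by apply: prodc_ext; rewrite !(pr1_pair, pr2_pair). Qed.

Lemma pairc_inj X A B (f f' : hom X A) (g g' : hom X B) :
  ⟨f, g⟩ = ⟨f', g'⟩ -> f = f' /\ g = g'.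
Proof.
move=> fg; split.
- by rewrite -(pr1_pair f g) fg pr1_pair.
- by rewrite -(pr2_pair f g) fg pr2_pair.
Qed.

Definition relc A B : Type := subobject (A × B).

(** The internal formula [R(a, b)] at stage [X]. *)
Definition relates X A B (R : relc A B) (a : hom X A) (b : hom X B) : Prop :=
  holds R ⟨a, b⟩.

Definition rel1 A B (R : relc A B) : hom (sub_dom R) A := pr1 ∘ sub_arr R.
Definition rel2 A B (R : relc A B) : hom (sub_dom R) B := pr2 ∘ sub_arr R.

(** The relation [{(a, b) | exists t, f t = a /\ g t = b}], as the image of
    [⟨f, g⟩], which need not be monic in general. Relational composition is the
    image of the span given by the pullback over the middle object. *)
Definition rel_span T A B (f : hom T A) (g : hom T B) : relc A B :=
  subobj_of (MonoTo (@im_monoP C _ _ ⟨f, g⟩)).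

Definition rel_comp A B D (S : relc B D) (R : relc A B) : relc A D :=
  rel_span (rel1 R ∘ pb1 (rel2 R) (rel1 S)) (rel2 S ∘ pb2 (rel2 R) (rel1 S)).

Definition rel_dag A B (R : relc A B) : relc B A := rel_span (rel2 R) (rel1 R).

(** [{((a, b), (a', b')) | R(a, a') /\ S(b, b')}] *)
Definition rel_tens A A' B B' (R : relc A A') (S : relc B B') :
    relc (A × B) (A' × B') :=
  rel_span ⟨rel1 R ∘ pr1, rel1 S ∘ pr2⟩ ⟨rel2 R ∘ pr1, rel2 S ∘ pr2⟩.

Definition rel_graph A B (f : hom A B) : relc A B := rel_span (idc A) f.

Lemma relates_arr A B (R : relc A B) : relates R (rel1 R) (rel2 R).
Proof. by exists (idc _); rewrite compc1 pairc_eta. Qed.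

Lemma relates_comp X Y A B (R : relc A B) (a : hom X A) (b : hom X B)
    (f : hom Y X) :
  relates R a b -> relates R (a ∘ f) (b ∘ f).
Proof. by move/(holds_comp f); rewrite pairc_comp. Qed.

Lemma relates_dom X A B (R : relc A B) (a : hom X A) (b : hom X B) :
  relates R a b <-> exists t, rel1 R ∘ t = a /\ rel2 R ∘ t = b.
Proof.
split=> [[t tE]|[t [<- <-]]]; last exact/relates_comp/relates_arr.
by exists t; rewrite /rel1 /rel2 -!compA tE pr1_pair pr2_pair.
Qed.

Lemma rel_arr_ext A B (R : relc A B) X (f g : hom X (sub_dom R)) :
  rel1 R ∘ f = rel1 R ∘ g -> rel2 R ∘ f = rel2 R ∘ g -> f = g.
Proof.
by move=> E1 E2; apply: (@sub_arrP _ _ R); apply: prodc_ext; rewrite !compA.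
Qed.

Lemma relates_ext A B (R S : relc A B) :
  (forall X (a : hom X A) (b : hom X B), relates R a b <-> relates S a b) ->
  R = S.
Proof.
by move=> RS; apply: subobj_ext => Y x; rewrite -(pairc_eta x); exact: RS.
Qed.

Lemma relates_descent X Y A B (R : relc A B) (a : hom X A) (b : hom X B)
    (e : hom Y X) :
  regular_epi e -> relates R (a ∘ e) (b ∘ e) -> relates R a b.
Proof. by move=> ee; rewrite /relates -pairc_comp; exact: holds_descent. Qed.

Lemma relates_span_intro T X A B (f : hom T A) (g : hom T B) (t : hom X T) :
  relates (rel_span f g) (f ∘ t) (g ∘ t).
Proof.
by apply/holds_of; exists (im_epi ⟨f, g⟩ ∘ t); rewrite compA im_fact pairc_comp.
Qed.

Lemma relates_span T X A B (f : hom T A) (g : hom T B)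
    (a : hom X A) (b : hom X B) :
  relates (rel_span f g) a b <->
  exists Y (e : hom Y X) (t : hom Y T),
    [/\ regular_epi e, f ∘ t = a ∘ e & g ∘ t = b ∘ e].
Proof.
split=> [/holds_of /= [h hE]|[Y [e [t [ee fE gE]]]]]; last first.
  by apply: (relates_descent ee); rewrite -fE -gE; exact: relates_span_intro.
set i := im_epi ⟨f, g⟩.
exists (pb i h), (pb2 i h), (pb1 i h).
have /pairc_inj [fE gE] : ⟨f ∘ pb1 i h, g ∘ pb1 i h⟩
    = ⟨a ∘ pb2 i h, b ∘ pb2 i h⟩.
  by rewrite -!pairc_comp -hE -compA -pb_comm compA im_fact.
by split=> //; apply: regular_epi_pb; exact: im_epiP.
Qed.

Lemma relates_span_monic T X A B (f : hom T A) (g : hom T B)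
    (a : hom X A) (b : hom X B) :
  monic ⟨f, g⟩ ->
  relates (rel_span f g) a b <-> exists t, f ∘ t = a /\ g ∘ t = b.
Proof.
move=> fgm; split=> [|[t [<- <-]]]; last exact: relates_span_intro.
move=> /relates_span [Y [e [t [ee fE gE]]]].
have : holds (subobj_of (MonoTo fgm)) (⟨a, b⟩ ∘ e).
  by apply/holds_of; exists t; rewrite /= !pairc_comp fE gE.
move=> /(holds_descent ee) /holds_of [/= s]; rewrite pairc_comp.
by move=> /pairc_inj []; exists s.
Qed.

Lemma relates_comp_intro X A B D (S : relc B D) (R : relc A B)
    (a : hom X A) (b : hom X B) (d : hom X D) :
  relates R a b -> relates S b d -> relates (rel_comp S R) a d.
Proof.
move=> /relates_dom [r [<- rE]] /relates_dom [s [sE <-]].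
have [|t [[tr ts] _]] := @pb_univ C _ _ _ (rel2 R) (rel1 S) _ r s.
  by rewrite rE sE.
by rewrite -tr -ts !compA; exact: relates_span_intro.
Qed.

Lemma relates_comp_elim X A B D (S : relc B D) (R : relc A B)
    (a : hom X A) (d : hom X D) :
  relates (rel_comp S R) a d ->
  exists Y (e : hom Y X) (b : hom Y B),
    [/\ regular_epi e, relates R (a ∘ e) b & relates S b (d ∘ e)].
Proof.
move=> /relates_span [Y [e [t [ee aE dE]]]].
exists Y, e, (rel2 R ∘ pb1 (rel2 R) (rel1 S) ∘ t); split=> //.
- by rewrite -aE; apply/relates_comp/relates_comp/relates_arr.
- rewrite -dE pb_comm; apply/relates_comp/relates_comp/relates_arr.
Qed.

Lemma relates_dag X A B (R : relc A B) (a : hom X A) (b : hom X B) :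
  relates (rel_dag R) b a <-> relates R a b.
Proof.
have Rm : monic ⟨rel2 R, rel1 R⟩.
  move=> Y f g; rewrite !pairc_comp => /pairc_inj [E2 E1].
  exact: rel_arr_ext.
rewrite /rel_dag relates_span_monic // relates_dom.
by split=> -[t []]; exists t.
Qed.

Lemma relates_tens X A A' B B' (R : relc A A') (S : relc B B')
    (x : hom X (A × B)) (y : hom X (A' × B')) :
  relates (rel_tens R S) x y <->
  relates R (pr1 ∘ x) (pr1 ∘ y) /\ relates S (pr2 ∘ x) (pr2 ∘ y).
Proof.
split=> [|[]].
  move=> /relates_span [Y [e [t [ee]]]]; rewrite !pairc_comp -!compA => xE yE.
  split; apply: (relates_descent ee); rewrite -!compA -xE -yE.
- by apply/relates_dom; exists (pr1 ∘ t); rewrite /rel1 /rel2 -!compA !pr1_pair.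
  - by apply/relates_dom; exists (pr2 ∘ t); rewrite /rel1 /rel2 -!compA !pr2_pair.
move=> /relates_dom [r [r1 r2]] /relates_dom [s [s1 s2]].
have -> : x = ⟨rel1 R ∘ pr1, rel1 S ∘ pr2⟩ ∘ ⟨r, s⟩.
  by rewrite -[LHS]pairc_eta -r1 -s1 pairc_comp -(compA (rel1 R)) -(compA (rel1 S))
     pr1_pair pr2_pair.
have -> : y = ⟨rel2 R ∘ pr1, rel2 S ∘ pr2⟩ ∘ ⟨r, s⟩.
  by rewrite -[LHS]pairc_eta -r2 -s2 pairc_comp -(compA (rel2 R)) -(compA (rel2 S))
     pr1_pair pr2_pair.
exact: relates_span_intro.
Qed.

Lemma relates_graph X A B (f : hom A B) (a : hom X A) (b : hom X B) :
  relates (rel_graph f) a b <-> f ∘ a = b.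
Proof.
have fm : monic ⟨idc A, f⟩.
  by move=> Y g h; rewrite !pairc_comp !comp1c => /pairc_inj [].
rewrite /rel_graph relates_span_monic //; split=> [[t []]|<-].
  by rewrite comp1c => ->.
by exists a; rewrite comp1c.
Qed.

Lemma rel_compA A B D E (T : relc D E) (S : relc B D) (R : relc A B) :
  rel_comp T (rel_comp S R) = rel_comp (rel_comp T S) R.
Proof.
apply: relates_ext => X a d; split=> /relates_comp_elim [Y [e [x [ee]]]].
  move=> /relates_comp_elim [Z [e' [b [ee' Rb Sb]]]] Tx.
  apply: (relates_descent ee); apply: (relates_descent ee').
  apply: (relates_comp_intro Rb); apply: (relates_comp_intro Sb).
  exact: relates_comp.
move=> Rx /relates_comp_elim [Z [e' [b [ee' Sb Tb]]]].
apply: (relates_descent ee); apply: (relates_descent ee').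
apply: (relates_comp_intro (relates_comp_intro _ Sb) Tb).
exact: relates_comp.
Qed.

Lemma rel_comp_graphr X A B D (S : relc B D) (f : hom A B)
    (a : hom X A) (d : hom X D) :
  relates (rel_comp S (rel_graph f)) a d <-> relates S (f ∘ a) d.
Proof.
split=> [/relates_comp_elim [Y [e [b [ee /relates_graph <-]]]]|].
  by rewrite compA; exact: relates_descent.
by apply: relates_comp_intro; exact/relates_graph.
Qed.

Lemma rel_comp_graphl X A B D (f : hom B D) (g : hom D B) (R : relc A B)
    (a : hom X A) (d : hom X D) : f ∘ g = idc _ -> g ∘ f = idc _ ->
  relates (rel_comp (rel_graph f) R) a d <-> relates R a (g ∘ d).
Proof.
move=> fg gf; split=> [/relates_comp_elim [Y [e [b [ee Rb]]]]|Ra].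
  move=> /relates_graph fb; apply: (relates_descent ee).
  by rewrite -compA -fb compA gf comp1c.
by apply: (relates_comp_intro Ra); apply/relates_graph; rewrite compA fg comp1c.
Qed.

Lemma rel_comp1c A B (R : relc A B) : rel_comp (rel_graph (idc B)) R = R.
Proof.
apply: relates_ext => X a b.
by rewrite (@rel_comp_graphl _ _ _ _ _ (idc B)) ?comp1c.
Qed.

Lemma rel_compc1 A B (R : relc A B) : rel_comp R (rel_graph (idc A)) = R.
Proof. by apply: relates_ext => X a b; rewrite rel_comp_graphr comp1c. Qed.

Definition Rel_cat : category :=
  Category rel_compA rel_comp1c rel_compc1.

Lemma rel_dagK A B (R : relc A B) : rel_dag (rel_dag R) = R.
Proof. by apply: relates_ext => X a b; rewrite !relates_dag. Qed.

Lemma rel_dag_id A : rel_dag (rel_graph (idc A)) = rel_graph (idc A).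
Proof.
apply: relates_ext => X a b; rewrite relates_dag !relates_graph !comp1c.
by split=> ->.
Qed.

Lemma rel_dag_comp A B D (S : relc B D) (R : relc A B) :
  rel_dag (rel_comp S R) = rel_comp (rel_dag R) (rel_dag S).
Proof.
apply: relates_ext => X d a; rewrite relates_dag.
split=> /relates_comp_elim [Y [e [b [ee Rb Sb]]]]; apply: (relates_descent ee).
- by apply: (@relates_comp_intro _ _ _ _ _ _ _ b); apply/relates_dag.
- by move/relates_dag: Rb Sb => Sb /relates_dag Rb; exact: relates_comp_intro Sb.
Qed.

Lemma rel_tens_id A B :
  rel_tens (rel_graph (idc A)) (rel_graph (idc B)) = rel_graph (idc (A × B)).
Proof.
apply: relates_ext => X a b; rewrite relates_tens !relates_graph !comp1c.
by split=> [[]|-> //]; exact: prodc_ext.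
Qed.

Lemma rel_tens_comp A A' A'' B B' B'' (R' : relc A' A'') (R : relc A A')
    (S' : relc B' B'') (S : relc B B') :
  rel_tens (rel_comp R' R) (rel_comp S' S)
  = rel_comp (rel_tens R' S') (rel_tens R S).
Proof.
apply: relates_ext => X x y; rewrite relates_tens; split.
  move=> [/relates_comp_elim [Y [e [a [ee Ra R'a]]]] Ss].
  have {Ss} := relates_comp e Ss.
  move=> /relates_comp_elim [Z [e' [b [ee' Sb S'b]]]].
  apply: (relates_descent ee); apply: (relates_descent ee').
  apply: (@relates_comp_intro _ _ _ _ _ _ _ ⟨a ∘ e', b⟩);
    apply/relates_tens; rewrite pr1_pair pr2_pair !compA; split=> //.
  - exact: relates_comp.
  - exact: relates_comp.
move=> /relates_comp_elim [Y [e [z [ee /relates_tens [Ra Sb]]]]].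
move=> /relates_tens [R'a S'b].
by split; apply: (relates_descent ee); rewrite -!compA;
  [exact: relates_comp_intro R'a | exact: relates_comp_intro S'b].
Qed.

Lemma rel_dag_tens A A' B B' (R : relc A A') (S : relc B B') :
  rel_dag (rel_tens R S) = rel_tens (rel_dag R) (rel_dag S).
Proof.
by apply: relates_ext => X x y; rewrite !(relates_dag, relates_tens).
Qed.

Lemma rel_dag_graph A B (f : hom A B) (g : hom B A) :
  f ∘ g = idc _ -> g ∘ f = idc _ -> rel_dag (rel_graph f) = rel_graph g.
Proof.
move=> fg gf; apply: relates_ext => X b a.
rewrite relates_dag !relates_graph.
by split=> <-; rewrite compA ?fg ?gf comp1c.
Qed.

Lemma rel_graph_comp A B D (g : hom B D) (f : hom A B) :
  rel_comp (rel_graph g) (rel_graph f) = rel_graph (g ∘ f).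
Proof.
by apply: relates_ext => X a d; rewrite rel_comp_graphr !relates_graph compA.
Qed.

Lemma rel_graph_tens A A' B B' (f : hom A A') (g : hom B B') :
  rel_tens (rel_graph f) (rel_graph g) = rel_graph ⟨f ∘ pr1, g ∘ pr2⟩.
Proof.
apply: relates_ext => X x y.
rewrite relates_tens !relates_graph -(pairc_eta y) pairc_comp !compA.
rewrite pr1_pair pr2_pair.
by split=> [[-> ->] //|/pairc_inj].
Qed.

Definition assocm A B D : hom (A × B × D) (A × (B × D)) :=
  ⟨pr1 ∘ pr1, ⟨pr2 ∘ pr1, pr2⟩⟩.
Definition assocV A B D : hom (A × (B × D)) (A × B × D) :=
  ⟨⟨pr1, pr1 ∘ pr2⟩, pr2 ∘ pr2⟩.
Definition lunitV A : hom A (term × A) := ⟨bang A, idc A⟩.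
Definition runitV A : hom A (A × term) := ⟨idc A, bang A⟩.

Lemma pr1_pairA X Y A B (h : hom A Y) (f : hom X A) (g : hom X B) :
  h ∘ pr1 ∘ ⟨f, g⟩ = h ∘ f.
Proof. by rewrite -compA pr1_pair. Qed.

Lemma pr2_pairA X Y A B (h : hom B Y) (f : hom X A) (g : hom X B) :
  h ∘ pr2 ∘ ⟨f, g⟩ = h ∘ g.
Proof. by rewrite -compA pr2_pair. Qed.

Definition prodcE := (pairc_comp, compA, pr1_pair, pr2_pair, pr1_pairA,
  pr2_pairA, comp1c, compc1).

Lemma bang_eq A (f g : hom A (@term C)) : f = g.
Proof. by rewrite (bang_uniq f) (bang_uniq g). Qed.

Lemma assocmK A B D : assocm A B D ∘ assocV A B D = idc _.
Proof. by do !apply: prodc_ext; rewrite !prodcE. Qed.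

Lemma assocVK A B D : assocV A B D ∘ assocm A B D = idc _.
Proof. by do !apply: prodc_ext; rewrite !prodcE. Qed.

Lemma lunitK A : pr2 ∘ lunitV A = idc _.
Proof. by rewrite pr2_pair. Qed.

Lemma lunitVK A : lunitV A ∘ pr2 = idc _.
Proof. by apply: prodc_ext; rewrite ?prodcE //; exact: bang_eq. Qed.

Lemma runitK A : pr1 ∘ runitV A = idc _.
Proof. by rewrite pr1_pair. Qed.

Lemma runitVK A : runitV A ∘ pr1 = idc _.
Proof. by apply: prodc_ext; rewrite ?prodcE //; exact: bang_eq. Qed.

Definition rel_assoc A B D : relc (A × B × D) (A × (B × D)) :=
  rel_graph (assocm A B D).
Definition rel_lunit A : relc (term × A) A := rel_graph pr2.
Definition rel_runit A : relc (A × term) A := rel_graph pr1.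

Lemma rel_assoc_nat A A' B B' D D'
    (R : relc A A') (S : relc B B') (T : relc D D') :
  rel_comp (rel_assoc A' B' D') (rel_tens (rel_tens R S) T)
  = rel_comp (rel_tens R (rel_tens S T)) (rel_assoc A B D).
Proof.
apply: relates_ext => X x y.
rewrite rel_comp_graphr (rel_comp_graphl _ _ _ (assocmK _ _ _) (assocVK _ _ _)).
rewrite !relates_tens !prodcE; tauto.
Qed.

Lemma rel_lunit_nat A A' (R : relc A A') :
  rel_comp (rel_lunit A') (rel_tens (rel_graph (idc term)) R)
  = rel_comp R (rel_lunit A).
Proof.
apply: relates_ext => X x y.
rewrite rel_comp_graphr (rel_comp_graphl _ _ _ (lunitK _) (lunitVK _)).
rewrite relates_tens relates_graph !prodcE.
by split=> [[]|Rxy] //; split=> //; exact: bang_eq.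
Qed.

Lemma rel_runit_nat A A' (R : relc A A') :
  rel_comp (rel_runit A') (rel_tens R (rel_graph (idc term)))
  = rel_comp R (rel_runit A).
Proof.
apply: relates_ext => X x y.
rewrite rel_comp_graphr (rel_comp_graphl _ _ _ (runitK _) (runitVK _)).
rewrite relates_tens relates_graph !prodcE.
by split=> [[]|Rxy] //; split=> //; exact: bang_eq.
Qed.

Lemma rel_graph_unitary A B (f : hom A B) (g : hom B A) :
  f ∘ g = idc _ -> g ∘ f = idc _ ->
  rel_comp (rel_dag (rel_graph f)) (rel_graph f) = rel_graph (idc A) /\
  rel_comp (rel_graph f) (rel_dag (rel_graph f)) = rel_graph (idc B).
Proof.
by move=> fg gf; rewrite (rel_dag_graph fg gf) !rel_graph_comp fg gf.
Qed.

Lemma rel_pentagon A B D E :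
  rel_comp (rel_comp (rel_tens (rel_graph (idc A)) (rel_assoc B D E))
                     (rel_assoc A (B × D) E))
           (rel_tens (rel_assoc A B D) (rel_graph (idc E)))
  = rel_comp (rel_assoc A B (D × E)) (rel_assoc (A × B) D E).
Proof.
rewrite /rel_assoc !rel_graph_tens !rel_graph_comp; congr rel_graph.
by do !apply: prodc_ext; rewrite !prodcE.
Qed.

Lemma rel_triangle A B :
  rel_comp (rel_tens (rel_graph (idc A)) (rel_lunit B)) (rel_assoc A term B)
  = rel_tens (rel_runit A) (rel_graph (idc B)).
Proof.
rewrite /rel_assoc !rel_graph_tens !rel_graph_comp; congr rel_graph.
by do !apply: prodc_ext; rewrite !prodcE.
Qed.

Definition Rel : monoidal_dagger_category :=
  @MonoidalDaggerCategory Rel_cat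
    rel_dag rel_dagK rel_dag_id rel_dag_comp
    term prodc rel_tens rel_tens_id rel_tens_comp rel_dag_tens
    rel_assoc rel_lunit rel_runit rel_assoc_nat rel_lunit_nat rel_runit_nat
    (fun A B D => (rel_graph_unitary (assocmK A B D) (assocVK A B D)).1)
    (fun A B D => (rel_graph_unitary (assocmK A B D) (assocVK A B D)).2)
    (fun A => (rel_graph_unitary (lunitK A) (lunitVK A)).1)
    (fun A => (rel_graph_unitary (lunitK A) (lunitVK A)).2)
    (fun A => (rel_graph_unitary (runitK A) (runitVK A)).1)
    (fun A => (rel_graph_unitary (runitK A) (runitVK A)).2)
    rel_pentagon rel_triangle.

Definition rel_eta A : relc term (A × A) := rel_span (bang A) ⟨idc A, idc A⟩.
Definition rel_eps A : relc (A × A) term := rel_span ⟨idc A, idc A⟩ (bang A).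

Lemma relates_eta X A (s : hom X term) (x : hom X (A × A)) :
  relates (rel_eta A) s x <-> pr1 ∘ x = pr2 ∘ x.
Proof.
split=> [/relates_span [Y [e [t [ee _ xE]]]]|xE].
  by apply: (regular_epi_epi ee); rewrite -!compA -xE !prodcE.
have -> : x = ⟨idc A, idc A⟩ ∘ (pr1 ∘ x).
  by rewrite pairc_comp comp1c {2}xE pairc_eta.
by rewrite (bang_eq s (bang A ∘ (pr1 ∘ x))); exact: relates_span_intro.
Qed.

Lemma rel_dag_span T A B (f : hom T A) (g : hom T B) :
  rel_dag (rel_span f g) = rel_span g f.
Proof.
apply: relates_ext => X a b; rewrite relates_dag !relates_span.
by split=> -[Y [e [t []]]]; exists Y, e, t.
Qed.

Lemma relates_eps X A (x : hom X (A × A)) (s : hom X term) :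
  relates (rel_eps A) x s <-> pr1 ∘ x = pr2 ∘ x.
Proof. by rewrite /rel_eps -rel_dag_span relates_dag relates_eta. Qed.

Lemma rel_snake A :
  rel_comp (rel_comp (rel_comp (rel_comp (rel_lunit A)
    (rel_tens (rel_eps A) (rel_graph (idc A)))) (rel_dag (rel_assoc A A A)))
    (rel_tens (rel_graph (idc A)) (rel_eta A))) (rel_dag (rel_runit A))
  = rel_graph (idc A).
Proof.
rewrite (rel_dag_graph (assocmK _ _ _) (assocVK _ _ _)).
rewrite (rel_dag_graph (runitK _) (runitVK _)).
apply: relates_ext => X a c; rewrite rel_comp_graphr relates_graph comp1c.
split=> [/relates_comp_elim [Y [e [b [ee]]]]|<-].
  rewrite rel_comp_graphr (rel_comp_graphl _ _ _ (lunitK _) (lunitVK _)).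
  rewrite !relates_tens !relates_graph relates_eps relates_eta !prodcE.
  by move=> [b1 b2] [b3 b4]; apply: (regular_epi_epi ee); rewrite b1 b3 b2.
apply: (@relates_comp_intro _ _ _ _ _ _ _ ⟨a, ⟨a, a⟩⟩).
  by rewrite relates_tens relates_graph relates_eta !prodcE.
rewrite rel_comp_graphr (rel_comp_graphl _ _ _ (lunitK _) (lunitVK _)).
by rewrite relates_tens relates_graph relates_eps !prodcE.
Qed.

Lemma rel_snake_dual A :
  rel_comp (rel_comp (rel_comp (rel_comp (rel_runit A)
    (rel_tens (rel_graph (idc A)) (rel_eps A))) (rel_assoc A A A))
    (rel_tens (rel_eta A) (rel_graph (idc A)))) (rel_dag (rel_lunit A))
  = rel_graph (idc A).
Proof.
rewrite (rel_dag_graph (lunitK _) (lunitVK _)).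
apply: relates_ext => X a c; rewrite rel_comp_graphr relates_graph comp1c.
split=> [/relates_comp_elim [Y [e [b [ee]]]]|<-].
  rewrite rel_comp_graphr (rel_comp_graphl _ _ _ (runitK _) (runitVK _)).
  rewrite !relates_tens !relates_graph relates_eps relates_eta !prodcE.
  by move=> [b1 b2] [b3 b4]; apply: (regular_epi_epi ee); rewrite b2 -b4 -b1.
apply: (@relates_comp_intro _ _ _ _ _ _ _ ⟨⟨a, a⟩, a⟩).
  by rewrite relates_tens relates_graph relates_eta !prodcE.
rewrite rel_comp_graphr (rel_comp_graphl _ _ _ (runitK _) (runitVK _)).
by rewrite relates_tens relates_graph relates_eps !prodcE.
Qed.

Definition rel_dual A : @dagger_dual Rel A A :=
  @DaggerDual Rel A A (rel_eta A) (rel_eps A) (rel_snake A) (rel_snake_dual A).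

Record equivalence_relation A (R : relc A A) : Prop := EquivalenceRelation {
  _ : forall X (x : hom X A), relates R x x;
  _ : forall X (x y : hom X A), relates R x y -> relates R y x;
  _ : forall X (x y z : hom X A),
        relates R x y -> relates R y z -> relates R x z
}.

(** The object [R ×_A S] of triples [(x, y, z)] with [R(x, y)] and [S(y, z)]. *)
Definition comp_pairs A (R S : relc A A) : C := pb (rel2 R) (rel1 S).
Definition cp_x A (R S : relc A A) : hom (comp_pairs R S) A :=
  rel1 R ∘ pb1 (rel2 R) (rel1 S).
Definition cp_y A (R S : relc A A) : hom (comp_pairs R S) A :=
  rel2 R ∘ pb1 (rel2 R) (rel1 S).
Definition cp_z A (R S : relc A A) : hom (comp_pairs R S) A :=
  rel2 S ∘ pb2 (rel2 R) (rel1 S).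

(** [(x, y, z)] lies in [R ×_A S] and [p(x, y, z) = u]; the element [t] is
    unique if it exists. *)
Definition partial_eval A (R S : relc A A) (p : hom (comp_pairs R S) A)
    X (x y z u : hom X A) : Prop :=
  exists t : hom X (comp_pairs R S),
    [/\ cp_x R S ∘ t = x, cp_y R S ∘ t = y, cp_z R S ∘ t = z & p ∘ t = u].

Record is_connector A (R S : relc A A) (p : hom (comp_pairs R S) A) : Prop :=
    IsConnector {
  _ : forall X (x y z u : hom X A), partial_eval p x y z u -> relates S x u;
  _ : forall X (x y z u : hom X A), partial_eval p x y z u -> relates R z u;
  _ : forall X (x y u : hom X A), partial_eval p x y y u -> u = x;
  _ : forall X (y z u : hom X A), partial_eval p y y z u -> u = z;
  _ : forall X (x y z u v w : hom X A),
        (exists q, partial_eval p x y z q /\ partial_eval p q u v w) <->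
        (exists q, partial_eval p z u v q /\ partial_eval p x y q w)
}.

Record connector A := Connector {
  conn_R : relc A A;
  conn_S : relc A A;
  conn_R_equiv : equivalence_relation conn_R;
  conn_S_equiv : equivalence_relation conn_S;
  conn_p : hom (comp_pairs conn_R conn_S) A;
  conn_pP : is_connector conn_p
}.

End Relations.

Arguments Rel C : clear implicits.

(* Main.v *)
Require Import Defs.
From mathcomp Require Import all_boot.
From mathcomp Require Import boolp.
(* Takes [compA], [left_loop] and [right_loop] back from [ssrfun]. *)
Import Defs.
Set Implicit Arguments.
Unset Strict Implicit.
Unset Printing Implicit Defensive.
Local Open Scope cat_scope.

(** Write [m(x, y, z, u)] for [m((x, y, z), u)]. Unwinding the string diagrams,
    dagger symmetry says that [m(x, y, z, u)], [m(u, z, y, x)] and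
    [m(y, x, u, z)] are equivalent, and normality that [m(y, y, z, u)] implies
    [u = z], that [m(x, y, y, u)] implies [u = x], and that [m(x, x, x, x)]
    always holds. Associativity then makes [m] single-valued: from
    [m(x, y, z, u)] and [m(u', z, y, x)] reassociating
    [m(m(u', z, y), y, z) = u] gives [m(u', z, z, u)], so [u = u']. The domain of
    [m] is [R ×_A S] for [R(x, y) := m(x, y, y, x)] and
    [S(y, z) := m(y, y, z, z)], and in a regular category a total
    single-valued relation is the graph of a morphism. Conversely, the graph of
    a connector has these properties, the symmetries coming from
    [p(p(x, y, z), z, y) = p(x, y, p(z, z, y)) = x] and its mirror image. *)

Section TernaryRelations.
Context {C : regular_category} {A : C}.
Implicit Types X Y : C.

Lemma pairc_surj X (B D : C) (b : hom X (B × D)) : exists b1 b2, b = ⟨b1, b2⟩.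
Proof. by exists (pr1 ∘ b), (pr2 ∘ b); rewrite pairc_eta. Qed.

Lemma rel_dag_eps (B : C) : rel_dag (rel_eps B) = rel_eta B.
Proof. exact: rel_dag_span. Qed.

(** * The Frobenius diagrams read in the internal logic *)

Section Formulas.
Variable m : relc (A × A × A) A.

Definition ternary X (x y z u : hom X A) : Prop := relates m ⟨⟨x, y⟩, z⟩ u.

Lemma ternary_comp X Y (x y z u : hom X A) (f : hom Y X) :
  ternary x y z u -> ternary (x ∘ f) (y ∘ f) (z ∘ f) (u ∘ f).
Proof. by move/(relates_comp f); rewrite !pairc_comp. Qed.

Lemma ternary_descent X Y (x y z u : hom X A) (e : hom Y X) : regular_epi e ->
  ternary (x ∘ e) (y ∘ e) (z ∘ e) (u ∘ e) -> ternary x y z u.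
Proof. by move=> ee; rewrite /ternary -!pairc_comp; exact: relates_descent. Qed.

(** The cup [eta] doubles [z] and the cup [eta'] doubles [y], so [a] grows to [(a, z, y, y, z)];
    then [m] sends the first three entries to [x]. *)
Lemma relates_frob3_left X (a x y z : hom X A) :
  relates (frob3_left (rel_dual A) m) a ⟨⟨x, y⟩, z⟩ <->
  ternary a z y x.
Proof.
rewrite /frob3_left /eta' /= rel_dag_eps.
rewrite !(rel_dag_graph (assocmK _ _ _) (assocVK _ _ _)).
rewrite !(rel_dag_graph (runitK _) (runitVK _)) !rel_graph_tens.
rewrite rel_comp_graphr; split.
  move=> /relates_comp_elim [Y [e [b [ee]]]].
  have [b1 [b' ->]] := pairc_surj b; have [b2 [b3 ->]] := pairc_surj b'.
  rewrite !rel_comp_graphr relates_tens relates_graph relates_eta !prodcE.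
  move=> [<- <-] /relates_comp_elim [Z [e' [c [ee']]]].
  have [c' [c5 ->]] := pairc_surj c; have [c'' [c3 ->]] := pairc_surj c'.
  have [c1 [c2 ->]] := pairc_surj c''; have [c4 [c6 ->]] := pairc_surj c3.
  rewrite rel_comp_graphr !relates_tens !relates_graph relates_eta !prodcE.
  move=> [[/pairc_inj [<- <-] <-] <-].
  move=> [[+ c4E] b2E]; rewrite c4E b2E => mE.
  exact: ternary_descent ee (ternary_descent ee' mE).
move=> m1; apply: (@relates_comp_intro _ _ _ _ _ _ _ _ ⟨a, ⟨z, z⟩⟩).
  by rewrite relates_tens relates_graph relates_eta !prodcE.
rewrite !rel_comp_graphr.
apply: (@relates_comp_intro _ _ _ _ _ _ _ _ ⟨⟨⟨a, z⟩, ⟨y, y⟩⟩, z⟩).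
  by rewrite !relates_tens !relates_graph relates_eta !prodcE.
by rewrite rel_comp_graphr !relates_tens !relates_graph !prodcE.
Qed.

(** Mirror image: [a] grows to [(x, y, y, x, a)] and [m] sends the last three entries to [z]. *)
Lemma relates_frob3_right X (a x y z : hom X A) :
  relates (frob3_right (rel_dual A) m) a ⟨⟨x, y⟩, z⟩ <->
  ternary y x a z.
Proof.
rewrite /frob3_right /reassoc /eta' /= rel_dag_eps.
rewrite !(rel_dag_graph (assocmK _ _ _) (assocVK _ _ _)).
rewrite !(rel_dag_graph (runitK _) (runitVK _)).
rewrite !(rel_dag_graph (lunitK _) (lunitVK _)).
rewrite /rel_assoc !rel_graph_tens rel_graph_comp rel_comp_graphr; split.
  move=> /relates_comp_elim [Y [e [b [ee]]]].
  have [b' [b3 ->]] := pairc_surj b; have [b1 [b2 ->]] := pairc_surj b'.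
  rewrite !rel_comp_graphr relates_tens relates_graph relates_eta !prodcE.
  move=> [-> <-] /relates_comp_elim [Z [e' [c [ee']]]].
  have [c' [c5 ->]] := pairc_surj c; have [c'' [c4 ->]] := pairc_surj c'.
  have [c1 [c3 ->]] := pairc_surj c''; have [c2 [c6 ->]] := pairc_surj c3.
  rewrite !rel_comp_graphr !relates_tens !relates_graph relates_eta !prodcE.
  move=> [[[<- ->] <-] <-] [/pairc_inj [be ->] mE].
  apply: (ternary_descent ee); apply: (ternary_descent ee').
  by rewrite -be.
move=> m1; apply: (@relates_comp_intro _ _ _ _ _ _ _ _ ⟨⟨x, x⟩, a⟩).
  by rewrite relates_tens relates_graph relates_eta !prodcE.
rewrite rel_comp_graphr.
apply: (@relates_comp_intro _ _ _ _ _ _ _ _ ⟨⟨⟨x, ⟨y, y⟩⟩, x⟩, a⟩).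
  by rewrite !relates_tens !relates_graph relates_eta !prodcE.
by rewrite !rel_comp_graphr !relates_tens !relates_graph !prodcE.
Qed.

(** The looped value [b] is existentially quantified, so composition produces it only on a cover. *)
Lemma relates_left_loop X (a u : hom X A) :
  relates (left_loop (rel_dual A) m) a u <->
  exists Y (e : hom Y X) b, regular_epi e /\ ternary b b (a ∘ e) (u ∘ e).
Proof.
rewrite /left_loop /eta' /= rel_dag_eps.
rewrite !(rel_dag_graph (lunitK _) (lunitVK _)) rel_comp_graphr; split.
  move=> /relates_comp_elim [Y [e [b [ee]]]].
  have [b' [b3 ->]] := pairc_surj b; have [b1 [b2 ->]] := pairc_surj b'.
  rewrite relates_tens relates_graph relates_eta !prodcE.
  by move=> [-> <-] mE; exists Y, e, b2.
move=> [Y [e [b [ee mE]]]]; apply: (relates_descent ee).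
apply: relates_comp_intro mE.
by rewrite relates_tens relates_graph relates_eta !prodcE.
Qed.

Lemma relates_right_loop X (a u : hom X A) :
  relates (right_loop (rel_dual A) m) a u <->
  exists Y (e : hom Y X) b, regular_epi e /\ ternary (a ∘ e) b b (u ∘ e).
Proof.
rewrite /right_loop /=.
rewrite !(rel_dag_graph (assocmK _ _ _) (assocVK _ _ _)).
rewrite !(rel_dag_graph (runitK _) (runitVK _)) rel_comp_graphr; split.
  move=> /relates_comp_elim [Y [e [b [ee]]]].
  have [b1 [b' ->]] := pairc_surj b; have [b2 [b3 ->]] := pairc_surj b'.
  rewrite rel_comp_graphr relates_tens relates_graph relates_eta !prodcE.
  by move=> [<- ->] mE; exists Y, e, b3.
move=> [Y [e [b [ee mE]]]]; apply: (relates_descent ee).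
apply: (@relates_comp_intro _ _ _ _ _ _ _ _ ⟨a ∘ e, ⟨b, b⟩⟩).
  by rewrite relates_tens relates_graph relates_eta !prodcE.
by rewrite rel_comp_graphr !prodcE.
Qed.

Lemma frob3_assocE :
  @frob3_assoc (Rel C) A A m <->
  forall X (x y z u v w : hom X A),
    (exists Y (e : hom Y X) q, [/\ regular_epi e,
       ternary (z ∘ e) (u ∘ e) (v ∘ e) q &
       ternary (x ∘ e) (y ∘ e) q (w ∘ e)]) <->
    (exists Y (e : hom Y X) q, [/\ regular_epi e,
       ternary (x ∘ e) (y ∘ e) (z ∘ e) q &
       ternary q (u ∘ e) (v ∘ e) (w ∘ e)]).
Proof.
rewrite /frob3_assoc /reassoc /= /rel_assoc !rel_graph_tens rel_graph_comp.
set l := (X in X = _ <-> _); set r := (X in _ = X <-> _).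
have lE X (x y z u v w : hom X A) : relates l ⟨⟨⟨⟨x, y⟩, z⟩, u⟩, v⟩ w <->
    exists Y (e : hom Y X) q, [/\ regular_epi e,
       ternary (z ∘ e) (u ∘ e) (v ∘ e) q &
       ternary (x ∘ e) (y ∘ e) q (w ∘ e)].
  rewrite /l rel_comp_graphr; split.
    move=> /relates_comp_elim [Y [e [b [ee]]]].
    have [b' [q ->]] := pairc_surj b; have [b1 [b2 ->]] := pairc_surj b'.
    rewrite relates_tens relates_graph !prodcE.
    by move=> [/pairc_inj [<- <-] mq] mE; exists Y, e, q.
  move=> [Y [e [q [ee mq mE]]]]; apply: (relates_descent ee).
  by apply: relates_comp_intro mE; rewrite relates_tens relates_graph !prodcE.
have rE X (x y z u v w : hom X A) : relates r ⟨⟨⟨⟨x, y⟩, z⟩, u⟩, v⟩ w <->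
    exists Y (e : hom Y X) q, [/\ regular_epi e,
       ternary (x ∘ e) (y ∘ e) (z ∘ e) q &
       ternary q (u ∘ e) (v ∘ e) (w ∘ e)].
  rewrite /r; split.
    move=> /relates_comp_elim [Y [e [b [ee]]]].
    have [b' [b2 ->]] := pairc_surj b; have [q [b1 ->]] := pairc_surj b'.
    rewrite !relates_tens !relates_graph !prodcE.
    by move=> [[mq <-] <-] mE; exists Y, e, q.
  move=> [Y [e [q [ee mq mE]]]]; apply: (relates_descent ee).
  by apply: relates_comp_intro mE; rewrite !relates_tens !relates_graph !prodcE.
split=> [lr X x y z u v w|lr]; first by rewrite -lE -rE lr.
apply: relates_ext => X b w.
have [b1 [v ->]] := pairc_surj b; have [b2 [u ->]] := pairc_surj b1.
have [b3 [z ->]] := pairc_surj b2; have [x [y ->]] := pairc_surj b3.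
by rewrite lE rE; exact: lr.
Qed.


(** The intermediate value [q] in [heap_assoc] only exists on a cover of the
    current stage, as relational composition dictates; [heap_assoc_global] removes
    the cover once [m] is known to be single-valued. *)
Record partial_heap : Prop := PartialHeap {
  heap_assoc : forall X (x y z u v w : hom X A),
    (exists Y (e : hom Y X) q, [/\ regular_epi e,
       ternary (z ∘ e) (u ∘ e) (v ∘ e) q &
       ternary (x ∘ e) (y ∘ e) q (w ∘ e)]) <->
    (exists Y (e : hom Y X) q, [/\ regular_epi e,
       ternary (x ∘ e) (y ∘ e) (z ∘ e) q &
       ternary q (u ∘ e) (v ∘ e) (w ∘ e)]);
  heap_symL : forall X (x y z u : hom X A), ternary x y z u -> ternary u z y x;
  heap_symR : forall X (x y z u : hom X A), ternary x y z u -> ternary y x u z;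
  heap_unitL : forall X (y z u : hom X A), ternary y y z u -> z = u;
  heap_unitR : forall X (x y u : hom X A), ternary x y y u -> x = u;
  heap_diag : forall X (x : hom X A), ternary x x x x
}.

(** * Single-valuedness and domain of a partial heap *)

Section HeapTheory.
Hypothesis heap_m : partial_heap.

Lemma heap_functional X (x y z u u' : hom X A) :
  ternary x y z u -> ternary x y z u' -> u = u'.
Proof.
move=> mu /(heap_symL heap_m) mu'.
have [] := (heap_assoc heap_m u' z y y z u).2.
  by exists X, (idc X), x; rewrite !compc1; split=> //; exact: regular_epi_id.
move=> Y [e [q [ee /(heap_unitL heap_m) <- /(heap_unitR heap_m) uE]]].
exact/esym/(regular_epi_epi ee).
Qed.

(** [e] is the coequaliser of some [s] and [t]; [q ∘ s] and [q ∘ t] are values of [m] at the same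
    arguments, hence equal, so [q] factors through [e]. *)
Lemma heap_lift X Y (x y z : hom X A) (e : hom Y X) (q : hom Y A) :
  regular_epi e -> ternary (x ∘ e) (y ∘ e) (z ∘ e) q ->
  exists2 u, ternary x y z u & u ∘ e = q.
Proof.
move=> ee mq; have [K [s [t [est eU]]]] := ee.
have [|u [uE _]] := eU _ q; last first.
  by exists u => //; apply: (ternary_descent ee); rewrite uE.
apply: heap_functional (ternary_comp s mq) _.
by rewrite -!compA est !compA; exact: ternary_comp.
Qed.

Lemma heap_assoc_global X (x y z u v w : hom X A) :
  (exists q, ternary x y z q /\ ternary q u v w) <->
  (exists q, ternary z u v q /\ ternary x y q w).
Proof.
split=> [] [q [mq mw]].
- have [] := (heap_assoc heap_m x y z u v w).2.
    by exists X, (idc X), q; rewrite !compc1; split=> //; exact: regular_epi_id.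
  move=> Y [e [r [ee /(heap_lift ee) [r' mr <-] /(ternary_descent ee)]]].
  by exists r'.
- have [] := (heap_assoc heap_m x y z u v w).1.
    by exists X, (idc X), q; rewrite !compc1; split=> //; exact: regular_epi_id.
  move=> Y [e [r [ee /(heap_lift ee) [r' mr <-] /(ternary_descent ee)]]].
  by exists r'.
Qed.

(** By [heap_symL], [m(m(x, y, z), z, y) = x]; reassociating gives [m(x, y, m(z, z, y)) = x], whose
    inner value is [y]. *)
Lemma heap_domL X (x y z u : hom X A) : ternary x y z u -> ternary x y y x.
Proof.
move=> mu; have [|q [/(heap_unitL heap_m) <-] //] :=
  (heap_assoc_global x y z z y x).1.
by exists u; split=> //; exact: heap_symL.
Qed.

Lemma heap_domR X (x y z u : hom X A) : ternary x y z u -> ternary y y z z.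
Proof.
move=> mu; have [|q [/(heap_unitR heap_m) <-] //] :=
  (heap_assoc_global y x x y z z).2.
by exists u; split=> //; exact: heap_symR.
Qed.

(** [m(m(y, x, x), y, z) = z] is defined with inner value [y]; its other bracketing contains
    [m(x, y, z)]. *)
Lemma heap_total X (x y z : hom X A) :
  ternary x y y x -> ternary y y z z -> exists u, ternary x y z u.
Proof.
move=> /(heap_symR heap_m) mR mS.
have [|u [mu _]] := (heap_assoc_global y x x y z z).1; first by exists y.
by exists u.
Qed.

(** Projecting the domain of [m] to two coordinates need not be monic, so [heap_R] and [heap_S] are
    images; they are then shown to agree with [m(x, y, y, x)] and [m(y, y, z, z)]. *)
Definition heap_R : relc A A :=
  rel_span (pr1 ∘ pr1 ∘ rel1 m) (pr2 ∘ pr1 ∘ rel1 m).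
Definition heap_S : relc A A :=
  rel_span (pr2 ∘ pr1 ∘ rel1 m) (pr2 ∘ rel1 m).

Lemma relates_heap_R X (x y : hom X A) :
  relates heap_R x y <-> ternary x y y x.
Proof.
split=> [/relates_span [Y [e [t [ee tx ty]]]]|/relates_dom [t [tE _]]].
  apply: (ternary_descent ee); rewrite -tx -ty.
  apply: (@heap_domL _ _ _ (pr2 ∘ rel1 m ∘ t) (rel2 m ∘ t)).
  rewrite /ternary -!compA !pairc_eta.
  by exists t; rewrite pairc_eta.
have := relates_span_intro (pr1 ∘ pr1 ∘ rel1 m) (pr2 ∘ pr1 ∘ rel1 m) t.
by rewrite -!(compA _ (rel1 m) t) tE
   !(pr1_pairA, pr2_pairA, pr1_pair, pr2_pair).
Qed.

Lemma relates_heap_S X (y z : hom X A) :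
  relates heap_S y z <-> ternary y y z z.
Proof.
split=> [/relates_span [Y [e [t [ee ty tz]]]]|/relates_dom [t [tE _]]].
  apply: (ternary_descent ee); rewrite -ty -tz.
  apply: (@heap_domR _ (pr1 ∘ pr1 ∘ rel1 m ∘ t) _ _ (rel2 m ∘ t)).
  rewrite /ternary -!compA !pairc_eta.
  by exists t; rewrite pairc_eta.
have := relates_span_intro (pr2 ∘ pr1 ∘ rel1 m) (pr2 ∘ rel1 m) t.
by rewrite -!(compA _ (rel1 m) t) tE
   !(pr1_pairA, pr2_pairA, pr1_pair, pr2_pair).
Qed.

Lemma heap_R_equiv : equivalence_relation heap_R.
Proof.
split=> X.
- by move=> x; apply/relates_heap_R/heap_diag.
- by move=> x y; rewrite !relates_heap_R; exact: heap_symR.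
- move=> x y z; rewrite !relates_heap_R => mxy myz.
  (* [m(x, y, m(y, z, z)) = x] reassociates to [m(m(x, y, y), z, z) = x]. *)
  have [|q [/(heap_unitR heap_m) <-] //] := (heap_assoc_global x y y z z x).2.
  by exists y.
Qed.

Lemma heap_S_equiv : equivalence_relation heap_S.
Proof.
split=> X.
- by move=> x; apply/relates_heap_S/heap_diag.
- by move=> x y; rewrite !relates_heap_S; exact: heap_symL.
- move=> x y z; rewrite !relates_heap_S => mxy myz.
  have [|q [/(heap_unitL heap_m) <-] //] := (heap_assoc_global x x y y z z).1.
  by exists y.
Qed.

End HeapTheory.

(** * Equivalence of the diagrammatic and the elementwise axioms *)

Lemma normal_frob3P :
  is_frob3 (rel_dual A) m /\ frob3_normal (rel_dual A) m <-> partial_heap.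
Proof.
have dagE X (x y z u : hom X A) :
    relates (rel_dag m) u ⟨⟨x, y⟩, z⟩ <-> ternary x y z u.
  exact: relates_dag.
split=> [[[/frob3_assocE mA mL mR] [loopL loopR]]|[mA mL mR uL uR mD]].
  have symL X (x y z u : hom X A) : ternary x y z u -> ternary u z y x.
    by move=> /dagE; rewrite -[rel_dag m]mL => /relates_frob3_left.
  have symR X (x y z u : hom X A) : ternary x y z u -> ternary y x u z.
    by move=> /dagE; rewrite [rel_dag m]mR => /relates_frob3_right.
  have unitL X (y z u : hom X A) : ternary y y z u -> z = u.
    move=> mu; rewrite -[z]comp1c; apply/relates_graph.
    rewrite -[rel_graph _]loopL; apply/relates_left_loop.
    by exists X, (idc X), y; rewrite !compc1; split=> //; exact: regular_epi_id.
  have unitR X (x y u : hom X A) : ternary x y y u -> x = u.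
    move=> mu; rewrite -[x]comp1c; apply/relates_graph.
    rewrite -[rel_graph _]loopR; apply/relates_right_loop.
    by exists X, (idc X), y; rewrite !compc1; split=> //; exact: regular_epi_id.
  split=> // X x.
  (* The left loop yields, on a cover, some [b] with [m(b, b, x, x)]; then [m(m(x, x, b), b, x) = x]
     reassociates to [m(x, x, m(b, b, x)) = x], which is [m(x, x, x, x)]. *)
  have : relates (rel_graph (idc A)) x x by apply/relates_graph; rewrite comp1c.
  rewrite -[rel_graph _]loopL => /relates_left_loop [Y [e [b [ee mb]]]].
  apply: (ternary_descent ee).
  have [] := (mA _ (x ∘ e) (x ∘ e) b b (x ∘ e) (x ∘ e)).2.
    exists Y, (idc Y), b; rewrite !compc1.
    by split=> //; [exact: regular_epi_id | exact: symL].
  move=> Z [e' [q [ee' /unitL <-]]]; exact: ternary_descent.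
split; split.
- exact/frob3_assocE.
- apply: relates_ext => X u w; have [w' [z ->]] := pairc_surj w.
  have [x [y ->]] := pairc_surj w'.
  by rewrite relates_frob3_left dagE; split=> /mL.
- apply: relates_ext => X u w; have [w' [z ->]] := pairc_surj w.
  have [x [y ->]] := pairc_surj w'.
  by rewrite relates_frob3_right dagE; split=> /mR.
- apply: relates_ext => X a u.
  rewrite relates_left_loop relates_graph comp1c.
  split=> [[Y [e [b [ee /uL]]]]|<-]; first exact: regular_epi_epi.
  (* By [heap_diag], [a] itself serves as the looped value. *)
  by exists X, (idc X), a; rewrite compc1; split=> //; exact: regular_epi_id.
- apply: relates_ext => X a u.
  rewrite relates_right_loop relates_graph comp1c.
  split=> [[Y [e [b [ee /uR]]]]|<-]; first exact: regular_epi_epi.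
  by exists X, (idc X), a; rewrite compc1; split=> //; exact: regular_epi_id.
Qed.

End Formulas.

(** * The graph of a connector *)

Section PartialOperations.
Context {R S : relc A A} (p : hom (comp_pairs R S) A).

(** The coordinate [y] is read off the [R]-leg of the pullback; [pb_comm] makes it the first
    coordinate of the [S]-leg too, so [x], [y], [z] determine both legs. *)
Lemma comp_pairs_ext X (s t : hom X (comp_pairs R S)) :
  cp_x R S ∘ s = cp_x R S ∘ t -> cp_y R S ∘ s = cp_y R S ∘ t ->
  cp_z R S ∘ s = cp_z R S ∘ t -> s = t.
Proof.
rewrite /cp_x /cp_y /cp_z -!(compA (rel1 R)) -!(compA (rel2 R)).
rewrite -!(compA (rel2 S)) => xE yE zE.
have comm : rel2 R ∘ (pb1 (rel2 R) (rel1 S) ∘ t)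
    = rel1 S ∘ (pb2 (rel2 R) (rel1 S) ∘ t) by rewrite !compA pb_comm.
have [h [_ hU]] := pb_univ comm.
rewrite -(hU t) // -(hU s) //; split; apply: rel_arr_ext => //.
by rewrite !(compA (rel1 S)) -pb_comm -!(compA (rel2 R)).
Qed.

Lemma comp_pairs_total X (x y z : hom X A) : relates R x y -> relates S y z ->
  exists t, [/\ cp_x R S ∘ t = x, cp_y R S ∘ t = y & cp_z R S ∘ t = z].
Proof.
move=> /relates_dom [r [xE rE]] /relates_dom [s [sE zE]].
have [|t [[tr ts] _]] := @pb_univ C _ _ _ (rel2 R) (rel1 S) _ r s.
  by rewrite rE sE.
exists t; rewrite /cp_x /cp_y /cp_z -(compA (rel1 R)) -(compA (rel2 R)).
by rewrite -(compA (rel2 S)) tr ts.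
Qed.

Lemma partial_eval_dom X (x y z u : hom X A) :
  partial_eval p x y z u -> relates R x y /\ relates S y z.
Proof.
move=> [t [<- <- <- _]]; split.
  exact/relates_comp/relates_comp/relates_arr.
by rewrite /cp_y pb_comm; exact/relates_comp/relates_comp/relates_arr.
Qed.

Lemma partial_eval_total X (x y z : hom X A) :
  relates R x y -> relates S y z -> exists u, partial_eval p x y z u.
Proof. by move=> Rxy /(comp_pairs_total Rxy) [t [? ? ?]]; exists (p ∘ t), t. Qed.

Definition partial_graph : relc (A × A × A) A :=
  rel_span ⟨⟨cp_x R S, cp_y R S⟩, cp_z R S⟩ p.

(** The span is monic by [comp_pairs_ext], so membership in its image involves no cover. *)
Lemma ternary_partial_graph X (x y z u : hom X A) :
  ternary partial_graph x y z u <-> partial_eval p x y z u.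
Proof.
rewrite /ternary relates_span_monic => [|Y f g]; last first.
  rewrite !pairc_comp => /pairc_inj [/pairc_inj [/pairc_inj []]] *.
  exact: comp_pairs_ext.
split=> -[t].
  by rewrite !pairc_comp => -[/pairc_inj [/pairc_inj [<- <-] <-] <-]; exists t.
by move=> [<- <- <- <-]; exists t; rewrite !pairc_comp.
Qed.

Lemma connector_heap : equivalence_relation R -> equivalence_relation S ->
  is_connector p -> partial_heap partial_graph.
Proof.
move=> [Rxx Rsym _] [Sxx Ssym _] [pS pR pUR pUL pA]; split=> X.
- move=> x y z u v w; split=> [] [Y [e [q [ee mq mw]]]].
    have [|r] := (pA _ (x ∘ e) (y ∘ e) (z ∘ e) (u ∘ e) (v ∘ e) (w ∘ e)).2.
      by exists q; rewrite -!ternary_partial_graph.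
    by rewrite -!ternary_partial_graph => -[]; exists Y, e, r.
  have [|r] := (pA _ (x ∘ e) (y ∘ e) (z ∘ e) (u ∘ e) (v ∘ e) (w ∘ e)).1.
    by exists q; rewrite -!ternary_partial_graph.
  by rewrite -!ternary_partial_graph => -[]; exists Y, e, r.
- move=> x y z u; rewrite !ternary_partial_graph => pu.
  have [_ Syz] := partial_eval_dom pu.
  (* [R(u, z)] and [S(z, y)] make [p(u, z, y)] defined; associativity then computes its value as
     [x]. *)
  have Ruz := Rsym _ _ _ (pR _ _ _ _ _ pu).
  have [w pw] := partial_eval_total Ruz (Ssym _ _ _ Syz).
  have [|q [/pUL -> /pUR wE]] := (pA _ x y z z y w).1; first by exists u.
  by rewrite -wE.
- move=> x y z u; rewrite !ternary_partial_graph => pu.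
  have [Rxy _] := partial_eval_dom pu.
  have Sxu := pS _ _ _ _ _ pu.
  have [w pw] := partial_eval_total (Rsym _ _ _ Rxy) Sxu.
  have [|q [/pUR -> /pUL wE]] := (pA _ y x x y z w).2; first by exists u.
  by rewrite -wE.
- by move=> y z u; rewrite ternary_partial_graph => /pUL.
- by move=> x y u; rewrite ternary_partial_graph => /pUR.
- move=> x; rewrite ternary_partial_graph.
  have [u pu] := partial_eval_total (Rxx _ x) (Sxx _ x).
  by rewrite -{4}(pUR _ _ _ _ pu).
Qed.

End PartialOperations.

(** * Recovering a connector from its graph *)

Lemma heap_connector (m : relc (A × A × A) A) : partial_heap m ->
  exists k : connector A, partial_graph (conn_p k) = m.
Proof.
move=> mH; set R := heap_R m; set S := heap_S m.
have domE X (x y z : hom X A) :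
    (exists u, ternary m x y z u) <-> relates R x y /\ relates S y z.
  rewrite relates_heap_R // relates_heap_S //; split=> [[u mu]|[]].
    by split; [exact: heap_domL mu | exact: heap_domR mu].
  exact: heap_total.
(* The generic triple, given by the projections of [R ×_A S], lies in the domain of [m]; its value
   is the morphism [p]. *)
have [|p mp] := (domE _ (cp_x R S) (cp_y R S) (cp_z R S)).2.
  (* [cp_x] is a placeholder operation: the aim is that the generic triple satisfies [R] and [S]. *)
  by apply: (@partial_eval_dom R S (cp_x R S) _ _ _ _ (cp_x R S));
     exists (idc _); rewrite !compc1.
have pE X (x y z u : hom X A) : partial_eval p x y z u <-> ternary m x y z u.
  split=> [[t [<- <- <- <-]]|mu]; first exact: ternary_comp.
  have [Rxy Syz] := (domE _ _ _ _).1 (ex_intro _ _ mu).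
  (* Every triple in the domain factors through the generic one, where [p] is the value of [m]. *)
  have [t [xE yE zE]] := comp_pairs_total Rxy Syz.
  exists t; split=> //; apply: (heap_functional mH) mu.
  by rewrite -xE -yE -zE; exact: ternary_comp.
have pP : is_connector p.
  split=> X.
  (* [S(x, u)] is read off the domain of [m(y, x, u, z)], and [R(z, u)] off that of
     [m(z, u, x, y)]. *)
  - move=> x y z u; rewrite pE => /(heap_symR mH) mu.
    exact: ((domE _ _ _ _).1 (ex_intro _ _ mu)).2.
  - move=> x y z u; rewrite pE => /(heap_symL mH)/(heap_symR mH) mu.
    exact: ((domE _ _ _ _).1 (ex_intro _ _ mu)).1.
  - by move=> x y u; rewrite pE => /(heap_unitR mH).
  - by move=> y z u; rewrite pE => /(heap_unitL mH).
  - move=> x y z u v w; split=> -[q []]; rewrite !pE => mq mw.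
      have [|r] := (heap_assoc_global mH x y z u v w).1; first by exists q.
      by rewrite -!pE; exists r.
    have [|r] := (heap_assoc_global mH x y z u v w).2; first by exists q.
    by rewrite -!pE; exists r.
exists (Connector (heap_R_equiv mH) (heap_S_equiv mH) pP).
apply: relates_ext => X b u; have [b' [z ->]] := pairc_surj b.
have [x [y ->]] := pairc_surj b'.
by rewrite -[relates _ _ _]/(ternary _ x y z u) ternary_partial_graph pE.
Qed.

(** The graph determines [R(x, y)] as [p(x, y, y) = x] and [S(y, z)] as [p(y, y, z) = z], and then
    [p] by its value at the generic triple. *)
Lemma connector_inj (k l : connector A) :
  partial_graph (conn_p k) = partial_graph (conn_p l) -> k = l.
Proof.
have RE (k' : connector A) X (x y : hom X A) :
    relates (conn_R k') x y <-> ternary (partial_graph (conn_p k')) x y y x.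
  case: k' => R S Req Seq p pP /=; rewrite ternary_partial_graph.
  case: Seq pP => Sxx _ _ [_ _ pUR _ _]; split=> [Rxy|/partial_eval_dom [] //].
  have [u pu] := partial_eval_total p Rxy (Sxx _ y).
  by rewrite -{2}(pUR _ _ _ _ pu).
have SE (k' : connector A) X (y z : hom X A) :
    relates (conn_S k') y z <-> ternary (partial_graph (conn_p k')) y y z z.
  case: k' => R S Req Seq p pP /=; rewrite ternary_partial_graph.
  case: Req pP => Rxx _ _ [_ _ _ pUL _]; split=> [Syz|/partial_eval_dom [] //].
  have [u pu] := partial_eval_total p (Rxx _ y) Syz.
  by rewrite -{2}(pUL _ _ _ _ pu).
move=> kl.
have R_eq : conn_R k = conn_R l by apply: relates_ext => X x y; rewrite !RE kl.
have S_eq : conn_S k = conn_S l by apply: relates_ext => X x y; rewrite !SE kl.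
case: k l R_eq S_eq kl {RE SE}.
move=> R S Req Seq p pP [R' S' Req' Seq' p' pP'] /= RR SS.
(* The type of [p] depends on [R] and [S], so these are identified before [p] and [p'] are
   compared. *)
case: R' / RR Req' p' pP'; case: S' / SS Seq' => Seq' Req' p' pP' kl.
have pp' : p = p'.
  (* At the generic triple the common graph gives [p = p' ∘ t], where [t] preserves all three
     coordinates and so is the identity. *)
  have : partial_eval p (cp_x R S) (cp_y R S) (cp_z R S) p.
    by exists (idc _); rewrite !compc1.
  rewrite -ternary_partial_graph kl ternary_partial_graph => -[t [xE yE zE <-]].
  suff -> : t = idc _ by rewrite compc1.
  by apply: comp_pairs_ext; rewrite compc1.
case: p' / pp' pP' {kl} => pP'.
by rewrite (Prop_irrelevance Req Req') (Prop_irrelevance Seq Seq')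
  (Prop_irrelevance pP pP').
Qed.

End TernaryRelations.

Theorem theorem6p5 (C : regular_category) (A : C) :
  exists Phi : connector A -> normal_frob3 (rel_dual A),
    bijective Phi /\
    forall (k : connector A) (X : C) (x y z u : hom X A),
      relates (frob3_mul (Phi k)) ⟨⟨x, y⟩, z⟩ u <->
      partial_eval (conn_p k) x y z u.
Proof.
have frobP (k : connector A) :=
  (normal_frob3P _).2
    (connector_heap (conn_R_equiv k) (conn_S_equiv k) (conn_pP k)).
exists (fun k => NormalFrob3 (frobP k).1 (frobP k).2); split; last first.
  by move=> k X x y z u; exact: ternary_partial_graph.
have surj (n : normal_frob3 (rel_dual A)) :
    exists k, partial_graph (conn_p k) = frob3_mul n.
  case: n => m mP mN; apply: heap_connector; exact/normal_frob3P.
(* A preimage of each structure is chosen; injectivity makes [Psi] a two-sided inverse. *)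
have [Psi PsiK] := choice surj; exists Psi => [k|n].
  by apply: connector_inj; rewrite PsiK.
(* The proof component mentions the relation being rewritten, so it is generalised first. *)
move: (PsiK n) (frobP (Psi n)); case: n => m mP mN /= -> mP' /=.
by congr NormalFrob3; exact: Prop_irrelevance.
Qed.
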